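(* Assume that: (1) $\mathscr{H}$ is separable; (2) the canonical feature map $\varphi : E\to\mathscr{H}$ is Borel measurable; (3) $\mathbb{E}[\|\varphi(X)\|_{\mathscr{H}}^2]<\infty$ and $\mathbb{E}[\|\varphi(Y)\|_{\mathscr{H}}^2]<\infty$. Then for every Hilbert--Schmidt operator $A:\mathscr{H}\to\mathscr{H}$, $$\|A-P\|^2_{\mathscr{H}\to L^2(\pi)}\le \mathbb{E}\left[\|F_p(X)-A^*\varphi(X)\|_{\mathscr{H}}^2\right]=\|F_p-A^*\varphi(\cdot)\|^2_{L^2(E,\mathcal{F}_E,\pi;\mathscr{H})} .$$ The bound is sharp, i.e. there exist $E,X,Y,\mathscr{H}$ such that $\mathscr{H}$ is separable, $\varphi:E\to\mathscr{H}$ is Borel measurable, $\mathbb{E}[\|\varphi(X)\|_{\mathscr{H}}^2]<\infty$ and $\mathbb{E}[\|\varphi(Y)\|_{\mathscr{H}}^2]<\infty$, and a Hilbert--Schmidt operator $A$ on $\mathscr{H}$ for which the inequality holds with equality and both sides are nonzero.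
   Context: Let $E$ be a second countable locally compact Hausdorff space with Borel $\sigma$-field $\mathcal{F}_E$, and let $X,Y$ be $E$-valued random variables on a common probability space $(\Omega,\mathcal{F},\mathbb{P})$ with laws $X\sim\pi$ and $Y\sim\nu$. Let $p:E\times\mathcal{F}_E\to[0,1]$ be a Markov kernel that is a regular version of the conditional distribution of $Y$ given $X$, i.e. $\mathbb{P}[X\in\mathcal{A},Y\in\mathcal{B}]=\int_{\mathcal{A}}p(x,\mathcal{B})\,d\pi(x)$ for all $\mathcal{A},\mathcal{B}\in\mathcal{F}_E$. Write $L^2(\pi)=L^2(E,\mathcal{F}_E,\pi;\mathbb{R})$. The conditional expectation operator is $P:L^2(\nu)\to L^2(\pi)$, $[Pf](x)=\mathbb{E}[f(Y)\mid X=x]=\int_E f(y)\,p(x,dy)$. $\mathscr{H}$ is the real reproducing kernel Hilbert space of functions $E\to\mathbb{R}$ with kernel $k:E\times E\to\mathbb{R}$ and canonical feature map $\varphi(x)=k(x,\cdot)$. Under (1)--(3), the inclusions $i_\pi:\mathscr{H}\to L^2(\pi)$ and $i_\nu:\mathscr{H}\to L^2(\nu)$, sending $f$ to its a.e.-equivalence class, are bounded. For bounded $A:\mathscr{H}\to\mathscr{H}$, the quantity $\|A-P\|_{\mathscr{H}\to L^2(\pi)}$ denotes the operator norm of $i_\pi A-P\,i_\nu:\mathscr{H}\to L^2(\pi)$. $L^2(E,\mathcal{F}_E,\pi;\mathscr{H})$ is the space of Bochner square integrable $\mathscr{H}$-valued functions. $F_p(x)=\mathbb{E}[\varphi(Y)\mid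 X=x]=\int_E\varphi(y)\,p(x,dy)$ is the ($\pi$-a.e. defined) conditional Bochner expectation, an element of $L^2(E,\mathcal{F}_E,\pi;\mathscr{H})$. $A^*$ is the adjoint of $A$ and $A^*\varphi(\cdot)$ is the function $x\mapsto A^*\varphi(x)$. *)

(* Defs.v *)
From HB Require Import structures.
From mathcomp Require Import all_boot all_order all_algebra.
From mathcomp Require Import all_classical all_reals all_analysis.

Set Implicit Arguments.
Unset Strict Implicit.
Unset Printing Implicit Defensive.

Import Order.TTheory GRing.Theory Num.Theory.
Import numFieldNormedType.Exports.

Local Open Scope classical_set_scope.
Local Open Scope ring_scope.

(* Convertible to [T], with the sigma-algebra generated by the open sets as
   measurable sets. Measurable types are pointed, whence [ptopologicalType]
   for the underlying space. *)
Notation borel T := (g_sigma_algebraType (@open T)).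

Definition separable (T : topologicalType) :=
  exists D : set T, countable D /\ dense D.

HB.mixin Record CompleteNormedModule_isHilbert (R : realType) H
    of CompleteNormedModule R H := {
  inner : {dot H for (@idfun R)} ;
  inner_norm : forall u : H, inner u u = `|u| ^+ 2
}.

#[short(type="hilbertType")]
HB.structure Definition Hilbert (R : realType) :=
  {H of CompleteNormedModule R H & CompleteNormedModule_isHilbert R H}.

Arguments inner {R s}.

Section operators.
Context {R : realType} {H : hilbertType R}.

Definition orthonormal_basis (B : set H) :=
  (forall u v, B u -> B v -> inner u v = (u == v)%:R) /\
  (forall w, (forall u, B u -> inner w u = 0) -> w = 0).

Definition hilbert_schmidt (A : {linear H -> H}) :=
  continuous A /\
  exists B : set H, orthonormal_basis B /\
    (\esum_(e in B) (`|A e| ^+ 2)%:E < +oo)%E.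

(* The adjoint of a bounded operator exists and is unique (Riesz); [xget] is
   the choice operator with default value [0]. *)
Definition adjoint (A : H -> H) (v : H) : H :=
  xget 0 [set w | forall u, inner (A u) v = inner u w].

End operators.

(* A Hilbert space of functions [E -> R] is given by a Hilbert space together
   with a linear injection [rkhs_fun] into the functions. *)
Record rkhs (R : realType) (E : Type) (k : E -> E -> R) := RKHS {
  rkhs_space :> hilbertType R ;
  rkhs_fun : {linear rkhs_space -> (E -> R^o)} ;
  rkhs_fun_inj : injective rkhs_fun ;
  feature : E -> rkhs_space ;
  feature_fun : forall x, rkhs_fun (feature x) = k x ;
  reproducing : forall (h : rkhs_space) x, inner h (feature x) = rkhs_fun h x
}.
Arguments rkhs_fun {R E k}.
Arguments feature {R E k}.

Section bochner.
Context d {T : measurableType d} {R : realType} {H : normedModType R}.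
Variable mu : {measure set T -> \bar R}.

Definition simple_function (s : T -> H) :=
  [/\ finite_set (range s),
      forall v, measurable (s @^-1` [set v]) &
      forall v, v != 0 -> (mu (s @^-1` [set v]) < +oo)%E].

Definition simple_integral (s : T -> H) : H :=
  \sum_(v \in range s) fine (mu (s @^-1` [set v])) *: v.

Definition strongly_measurable (f : T -> H) :=
  exists s : nat -> T -> H,
    (forall n, simple_function (s n)) /\ (forall t, s n t @[n --> \oo] --> f t).

Definition is_bochner_integral (f : T -> H) (v : H) :=
  strongly_measurable f /\
  exists s : nat -> T -> H,
    [/\ forall n, simple_function (s n),
        (\int[mu]_t `|f t - s n t|%:E)%E @[n --> \oo] --> 0%E &
        simple_integral (s n) @[n --> \oo] --> v].

Definition bochner_integral (f : T -> H) : H :=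
  xget 0 [set v | is_bochner_integral f v].

(* The norm of the Bochner space L^2(T, mu; H). *)
Definition bochner_L2norm (f : T -> H) : \bar R :=
  'N[mu]_2%:E[EFin \o (fun t => `|f t|)%R]%E.

(* The norm of an operator from H to L^2(mu), where [F h] is a representative
   of the image of h. *)
Definition opnorm_L2 (F : H -> T -> R) : \bar R :=
  ereal_sup [set 'N[mu]_2%:E[EFin \o F h]%E | h in [set h : H | `|h| <= 1]].

End bochner.

Definition regular_conditional_distribution (R : realType)
    (d : measure_display) (Omega : measurableType d) (P : probability Omega R)
    (E : ptopologicalType) (X Y : {RV P >-> borel E})
    (p : R.-pker (borel E) ~> (borel E)) :=
  forall A B : set (borel E), measurable A -> measurable B ->
    P (X @^-1` A `&` Y @^-1` B) = (\int[distribution P X]_(x in A) p x B)%E.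

Section conditional_mean.
Context {R : realType} {E : ptopologicalType}.
Variable p : R.-pker (borel E) ~> (borel E).

Definition condexp_op (f : E -> R) (x : E) : R := \int[p x]_y f y.

(* F_p; equal to 0 where the feature map is not Bochner p(x, .)-integrable. *)
Definition condexp_feature (k : E -> E -> R) (H : rkhs k) (x : E) : H :=
  bochner_integral (p x) (feature H).

(* The operator i_pi A - P i_nu. *)
Definition operator_error (k : E -> E -> R) (H : rkhs k) (A : {linear H -> H})
    (h : H) : borel E -> R :=
  fun x => rkhs_fun H (A h) x - condexp_op (rkhs_fun H h) x.

Definition feature_error (k : E -> E -> R) (H : rkhs k) (A : {linear H -> H}) :
    borel E -> H :=
  fun x => condexp_feature H x - adjoint A (feature H x).

End conditional_mean.

Definition feature_assumptions (R : realType)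
    (d : measure_display) (Omega : measurableType d) (P : probability Omega R)
    (E : ptopologicalType) (X Y : {RV P >-> borel E})
    (k : E -> E -> R) (H : rkhs k) :=
  [/\ separable H,
      measurable_fun [set: borel E] (feature H : borel E -> borel H),
      ('E_P[(fun w => `|feature H (X w)| ^+ 2)%R] < +oo)%E &
      ('E_P[(fun w => `|feature H (Y w)| ^+ 2)%R] < +oo)%E].

(* Main.v *)
Require Import Defs.
From HB Require Import structures.
From mathcomp Require Import all_boot all_order all_algebra.
From mathcomp Require Import finmap.
From mathcomp Require Import all_classical all_reals all_analysis.
From mathcomp Require Import measurable_realfun ring lra.
Set Implicit Arguments.
Unset Strict Implicit.
Unset Printing Implicit Defensive.
Import Order.TTheory GRing.Theory Num.Theory.
Import numFieldNormedType.Exports.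
Local Open Scope classical_set_scope.
Local Open Scope ring_scope.

(** Write phi for the feature map and err(x) = F_p(x) - A^* phi(x). By the
    reproducing property (A h)(x) = <A h, phi(x)> = <h, A^* phi(x)>, and since
    the Bochner integral commutes with <h, .>, the conditional expectation of h
    at x is the integral of <h, phi(y)> against p(x, dy), that is
    <h, F_p(x)>. Hence (A h - P h)(x) = - <h, err(x)> ([operator_errorE]), and
    Cauchy-Schwarz bounds this by |err(x)| for |h| <= 1. Squaring, integrating
    against the law of X and taking the supremum over h gives the inequality
    ([opnorm_L2_le]); the second expression for the right-hand side is a change
    of variables ([expectation_feature_error]).

    The adjoint and the Bochner integral have to be shown to exist, both being
    given by a choice operator with default value 0. For the adjoint
    this is the Riesz representation theorem ([riesz]). For the Bochner
    integral, a Borel function f into a separable space is approximated by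
    the simple functions sending t to the point nearest to f(t) among finitely
    many terms of a dense sequence ([nearest]); the limit of their integrals is
    produced by Riesz again, as the vector representing the functional
    h |-> int <h, f> ([is_bochner_integral_exists]).

    F_p(x) represents the conditional expectation only where phi is
    p(x, .)-integrable. This holds for almost every x, because integrating the
    p(x, .)-integral of |phi| over the law of X gives E |phi(Y)|, which is
    finite ([integrable_feature_ae]). Measurability of |err| follows from that
    of the scalar functions <h, err>, a squared norm being a supremum of
    countably many affine functionals ([norm_sqr_sup]).

    For sharpness it is enough to take the one-dimensional space of constant
    functions, a constant pair of variables and A = 0: then P h = h,
    both sides equal 1, and the supremum is attained at the constant
    function 1. *)

(** * Geometry of Hilbert spaces and the Riesz theorem *)

Section hilbert_geometry.
Context {R : realType} {H : hilbertType R}.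
Implicit Types u v w : H.

Lemma innerC u v : inner u v = inner v u.
Proof. by rewrite hermC /= expr0 mul1r. Qed.

Lemma innerZl t u v : inner (t *: u) v = t * inner u v.
Proof. exact: linearZl_LR. Qed.

Lemma innerZr t u v : inner u (t *: v) = t * inner u v.
Proof. by rewrite innerC innerZl innerC. Qed.

Lemma innerBr u v w : inner u (v - w) = inner u v - inner u w.
Proof. exact: linearBr. Qed.

Lemma norm_sqrD u v : `|u + v| ^+ 2 = `|u| ^+ 2 + 2 * inner u v + `|v| ^+ 2.
Proof.
by rewrite -!inner_norm linearDl !linearDr /= (innerC v u); ring.
Qed.

Lemma norm_sqrB u v : `|u - v| ^+ 2 = `|u| ^+ 2 - 2 * inner u v + `|v| ^+ 2.
Proof. by rewrite norm_sqrD linearNr normrN mulrN. Qed.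

Lemma cauchy_schwarz u v : `|inner u v| <= `|u| * `|v|.
Proof.
have [->|v0] := eqVneq v 0; first by rewrite linear0r !normr0 mulr0.
have v2_gt0 : 0 < `|v| ^+ 2 by rewrite exprn_gt0 // normr_gt0.
rewrite -ler_sqr ?nnegrE ?mulr_ge0 // -normrX ger0_norm ?sqr_ge0 // exprMn.
(* This square equals |v|^2 (|u|^2 |v|^2 - <u, v>^2). *)
have := sqr_ge0 (`| (`|v| ^+ 2) *: u - inner u v *: v|).
rewrite norm_sqrB innerZl innerZr !normrZ !exprMn.
rewrite !real_normK ?num_real// => h.
have {}h : 0 <= `|v| ^+ 2 * (`|u| ^+ 2 * `|v| ^+ 2 - inner u v ^+ 2).
  by apply: le_trans h _; rewrite le_eqVlt; apply/orP; left; apply/eqP; ring.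
by rewrite -subr_ge0 -(pmulr_rge0 _ v2_gt0).
Qed.

Lemma innerr_eq u v : (forall h, inner h u = inner h v) -> u = v.
Proof.
move=> uv; apply/eqP; rewrite -subr_eq0 -normr_eq0 -sqrf_eq0 -inner_norm.
by rewrite innerBr uv subrr.
Qed.

Lemma continuous_inner u : continuous (inner u : H -> R).
Proof.
move=> v; apply/cvgrPdist_le => e e0; near=> w.
rewrite -innerBr; apply: (le_trans (cauchy_schwarz _ _)).
(* The added 1 covers u = 0. *)
have : `|v - w| <= e / (`|u| + 1).
  near: w; apply: cvgr_dist_le; first exact: cvg_id.
  by rewrite divr_gt0// ltr_wpDl.
rewrite ler_pdivlMr ?ltr_wpDl// => h.
apply: le_trans h; rewrite mulrC ler_wpM2l// lerDl//.
Unshelve. all: by end_near. Qed.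

(** Completing the square, 2 <x_n, v> - |x_n|^2 = |v|^2 - |x_n - v|^2, whose
    supremum is |v|^2 as soon as the x_n are dense. This turns weak measurability
    of a Hilbert-valued function into measurability of its norm. *)
Lemma norm_sqr_sup (x : nat -> H) v : dense (range x) ->
  (`|v| ^+ 2)%:E =
  ereal_sup (range (fun n => (2 * inner (x n) v - `|x n| ^+ 2)%:E)).
Proof.
move=> dx.
have E n : 2 * inner (x n) v - `|x n| ^+ 2 = `|v| ^+ 2 - `|x n - v| ^+ 2.
  by rewrite norm_sqrB; ring.
apply/eqP; rewrite eq_le; apply/andP; split; last first.
  by apply: ge_ereal_sup => _ [n _ <-]; rewrite lee_fin E gerBl sqr_ge0.
apply/lee_addgt0Pr => e e0.
(* A point within sqrt e of v misses the supremum by at most e. *)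
have [] := dx (ball v (Num.sqrt e)).
- by exists v; apply: ballxx; rewrite sqrtr_gt0.
- by apply: ball_open; rewrite sqrtr_gt0.
move=> _ [] /[swap] -[n _ <-]; rewrite -ball_normE /= => xn.
apply: (@le_trans _ _ ((2 * inner (x n) v - `|x n| ^+ 2)%:E + e%:E)%E); last first.
  by rewrite leeD2r// ereal_sup_ubound//; exists n.
rewrite -EFinD lee_fin E -addrA lerDl addrC subr_ge0 distrC.
rewrite -(@sqr_sqrtr _ e) ?(ltW e0)// ler_sqr ?nnegrE ?sqrtr_ge0//.
exact: ltW.
Qed.

Section riesz.
Variables (l : {scalar H}) (M : R).
Hypothesis lM : forall u, `|l u| <= M * `|u|.

Let J u : R := `|u| ^+ 2 - 2 * l u.

Let J_lb u : - M ^+ 2 <= J u.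
Proof.
have := lM u; rewrite /J ler_norml => /andP[_ lu].
have := sqr_ge0 (`|u| - M); nra.
Qed.

Let J_has_inf : has_inf (range J).
Proof.
by split; [exists (J 0); exists 0 | exists (- M ^+ 2) => _ [u _ <-]; exact: J_lb].
Qed.

Let m := inf (range J).

Let J_ge u : m <= J u.
Proof. by apply: ge_inf; [exact: J_has_inf.2 | exists u]. Qed.

(** The parallelogram identity, with J bounded below by m at the midpoint. *)
Let near_min u v : `|u - v| ^+ 2 <= 2 * (J u - m) + 2 * (J v - m).
Proof.
have lE : l (2^-1 *: (u + v)) = 2^-1 * (l u + l v).
  by rewrite linearZ linearD.
have := J_ge (2^-1 *: (u + v)).
rewrite /J lE normrZ exprMn ger0_norm // norm_sqrB norm_sqrD; lra.
Qed.

(** A minimising sequence of the strictly convex functional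
    J u = |u|^2 - 2 l(u) is Cauchy by the parallelogram identity, and the
    first-order condition for J at its limit w reads l = <., w>. *)
Lemma riesz : exists w, forall u, l u = inner u w.
Proof.
have step n : exists u, J u < m + (@harmonic R n).
  have [_ [u _ <-] Ju] := inf_adherent (harmonic_gt0 n) J_has_inf.
  by exists u.
pose x n := projT1 (cid (step n)).
have Jx n : J (x n) < m + harmonic n by exact: projT2 (cid (step n)).
have : cvgn x.
  apply: cauchy_cvg; apply: cauchy_exP => e e0.
  have e4 : 0 < e ^+ 2 / 4 by rewrite divr_gt0 ?exprn_gt0.
  have := cvgr_lt 0 (@cvg_harmonic R) (e ^+ 2 / 4) e4.
  case => N _ hN; exists (x N); exists N => // n Nn.
  rewrite -ball_normE /= -ltr_sqr ?nnegrE ?(ltW e0)//.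
  have hn : harmonic n < e ^+ 2 / 4 by exact: (hN _ Nn).
  have hNN : harmonic N < e ^+ 2 / 4 by exact: (hN _ (leqnn N)).
  have := near_min (x N) (x n); have := Jx N; have := Jx n.
  move: hn hNN; set a := harmonic n; set b := harmonic N; lra.
set w := limn x => xw; exists w => u.
have cw : inner u (x n) @[n --> \oo] --> inner u w.
  by apply: continuous_cvg => //; exact: continuous_inner.
pose c := inner u w - l u; pose q := `|u| ^+ 2.
(* Let n tend to infinity in m <= J (x n + t u). *)
have first_order t : 0 <= 2 * t * c + t ^+ 2 * q.
  have : (2 * t * (inner u (x n) - l u) + t ^+ 2 * q) + harmonic n
      @[n --> \oo] --> (2 * t * c + t ^+ 2 * q) + 0.
    apply: cvgD; last exact: cvg_harmonic.
    apply: cvgD; last exact: cvg_cst.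
    by apply: cvgMr; apply: cvgB => //; exact: cvg_cst.
  rewrite addr0 => /cvgr_to_ge; apply; near=> n.
  have := J_ge (t *: u + x n); have := Jx n.
  rewrite /J norm_sqrD normrZ exprMn real_normK ?num_real// -/q.
  have -> : l (t *: u + x n) = t * l u + l (x n) by rewrite linearP.
  rewrite innerZl; set g := inner _ _; lra.
have q0 : 0 <= q by exact: sqr_ge0.
(* The parabola 2 t c + t^2 q is negative at this t unless c = 0; the added 1
   covers q = 0. *)
have {first_order} := first_order (- c / (q + 1)).
rewrite -(pmulr_rge0 _ (_ : 0 < (q + 1) ^+ 2)); last by rewrite exprn_gt0 ?ltr_wpDl.
have -> : (q + 1) ^+ 2 * (2 * (- c / (q + 1)) * c + (- c / (q + 1)) ^+ 2 * q) =
    - (c ^+ 2 * (q + 2)).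
  by field; rewrite gt_eqF ?ltr_wpDl.
rewrite oppr_ge0 pmulr_lle0 ?ltr_wpDl// => c0.
have : c ^+ 2 == 0 by rewrite eq_le c0 sqr_ge0.
by rewrite sqrf_eq0 subr_eq0 => /eqP.
Unshelve. all: by end_near. Qed.

End riesz.

(** Continuity of A makes u |-> <A u, v> a bounded functional, so that Riesz
    supplies a vector for the choice operator in [adjoint]. *)
Lemma adjointE (A : {linear H -> H}) : continuous A ->
  forall u v, inner u (adjoint A v) = inner (A u) v.
Proof.
move=> cA u v; rewrite /adjoint.
have /linear_boundedP : bounded_near A (nbhs 0).
  by apply/linear_bounded_continuous.
move=> [M [_ AM]].
have {}AM x : `|A x| <= (M + 1) * `|x| by apply: AM; rewrite ltrDl.
pose l x : R^o := inner (A x) v.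
have l_lin : scalar l by move=> t x y; rewrite /l linearP /= linearPl.
pose lH := GRing.isLinear.Build _ _ _ _ l l_lin.
pose L : {scalar H} := HB.pack l lH.
have [w lw] : exists w, forall u, L u = inner u w.
  apply: (@riesz L ((M + 1) * `|v|)) => x.
  rewrite (le_trans (cauchy_schwarz _ _))// mulrAC ler_wpM2r//.
case: xgetP => [y _ yP|/(_ w) /=]; first by rewrite -yP.
by case=> x; rewrite -lw.
Qed.

End hilbert_geometry.

(** * Borel functions into a separable Hilbert space *)

Section borel_functions.
Context d (T : measurableType d) {R : realType} {H : hilbertType R}.

Lemma continuous_borel_measurable (q : H -> R) : continuous q ->
  measurable_fun [set: borel H] (q : borel H -> R).
Proof.
move=> cq; apply: (measurability _ (RGenOInfty.measurableE R)).
move=> _ [_ [a ->] <-]; rewrite setTI; apply: sub_sigma_algebra.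
by move/continuousP : cq; apply; rewrite set_itvE; exact: open_gt.
Qed.

Lemma continuous_comp_measurable (f : T -> H) (q : H -> R) : continuous q ->
  measurable_fun [set: T] (f : T -> borel H) -> measurable_fun [set: T] (q \o f).
Proof. by move=> /continuous_borel_measurable; exact: measurableT_comp. Qed.

Lemma measurable_norm_sub (f : T -> H) (v : H) :
  measurable_fun [set: T] (f : T -> borel H) ->
  measurable_fun [set: T] (fun t => `|f t - v|).
Proof.
apply: (@continuous_comp_measurable f (fun u => `|u - v|)) => u.
apply: cvg_norm; apply: cvgB; [exact: cvg_id|exact: cvg_cst].
Qed.

Lemma measurable_normH (f : T -> H) :
  measurable_fun [set: T] (f : T -> borel H) ->
  measurable_fun [set: T] (fun t => `|f t|).
Proof. by move/(measurable_norm_sub 0); under eq_fun do rewrite subr0. Qed.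

Lemma measurable_inner (f : T -> H) h :
  measurable_fun [set: T] (f : T -> borel H) ->
  measurable_fun [set: T] (fun t => inner h (f t)).
Proof. exact: (@continuous_comp_measurable f (inner h) (@continuous_inner _ _ h)). Qed.

(** A function with finite range is locally a constant v on finitely many
    measurable pieces, on each of which q is the measurable function q v. *)
Lemma finite_range_measurable d' (U : measurableType d') (s : T -> H)
    (q : H -> T -> U) :
  finite_set (range s) -> (forall v, measurable (s @^-1` [set v])) ->
  (forall v, measurable_fun setT (q v)) ->
  measurable_fun setT (fun t => q (s t) t).
Proof.
move=> fs ms mq _ B mB; rewrite setTI.
have -> : (fun t => q (s t) t) @^-1` B =
    \bigcup_(v in range s) (s @^-1` [set v] `&` q v @^-1` B).
  apply/seteqP; split => [t Bt|t [v _ [<-//]]].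
  by exists (s t); [exists t | split].
apply: fin_bigcup_measurable => // v _; apply: measurableI => //.
by rewrite -[X in measurable X]setTI; exact: mq.
Qed.

Section nearest_point.
Variables (x : nat -> H) (f : T -> H).

(** The point nearest to f(t) among 0, x 0, ..., x (n - 1). Starting at 0 gives
    |f - nearest n| <= |f|, hence domination by |f|; updating one
    point at a time gives the measurability of the pieces by induction. *)
Fixpoint nearest n (t : T) : H :=
  if n is n'.+1 then
    if `|f t - x n'| < `|f t - nearest n' t| then x n' else nearest n' t
  else 0.

Lemma nearest_dist n t : `|f t - nearest n t| <= `|f t|.
Proof.
elim: n => [|n IH] /=; first by rewrite subr0.
by case: ifPn => // /ltW /le_trans; exact.
Qed.

Lemma nearest_best k n t : (k < n)%N -> `|f t - nearest n t| <= `|f t - x k|.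
Proof.
elim: n => // n IH; rewrite ltnS leq_eqVlt => /predU1P[->|/IH {}IH] /=.
  by case: ifPn => //; rewrite -leNgt.
by case: ifPn => // /ltW /le_trans; exact.
Qed.

Lemma cvg_nearest t : dense (range x) -> nearest n t @[n --> \oo] --> f t.
Proof.
move=> dx; apply/cvgrPdist_lt => e e0.
have [] := dx (ball (f t) e).
- by exists (f t); exact: ballxx.
- exact: ball_open.
move=> _ [] /[swap] -[k _ <-]; rewrite -ball_normE /= => xk.
by exists k.+1 => // n /= kn; apply: le_lt_trans xk; exact: nearest_best.
Qed.

Lemma nearest_finite n : finite_set (range (nearest n)).
Proof.
elim: n => [|n IH].
  by apply: (sub_finite_set _ (finite_set1 0)) => _ [t _ <-].
apply: (@sub_finite_set _ _ (range (nearest n) `|` [set x n])).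
  by move=> _ [t _ <-] /=; case: ifPn => _; [right|left; exists t].
by rewrite finite_setU; split.
Qed.

Lemma nearest_measurable n v : measurable_fun [set: T] (f : T -> borel H) ->
  measurable (nearest n @^-1` [set v]).
Proof.
move=> mf; elim: n v => [|n IH] v.
  rewrite [X in measurable X](_ : _ = if 0 == v then setT else set0).
    by case: ifPn.
  by apply/seteqP; split => t /=; [move=> <-; rewrite eqxx|case: eqVneq].
pose C := [set t | `|f t - x n| < `|f t - nearest n t|].
have mC : measurable C.
  have : measurable_fun setT (fun t => `|f t - x n| < `|f t - nearest n t|).
    apply: measurable_fun_ltr; first exact: measurable_norm_sub.
    apply: (finite_range_measurable (q := fun v t => `|f t - v|)) => //.
      exact: nearest_finite.
    by move=> u; exact: measurable_norm_sub.
  by move=> /(_ measurableT [set true] I); rewrite setTI.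
rewrite [X in measurable X](_ : _ = (C `&` (if x n == v then setT else set0))
    `|` (~` C `&` nearest n @^-1` [set v])).
  apply: measurableU; apply: measurableI => //; first by case: ifPn.
  exact: measurableC.
apply/seteqP; split => t /=; rewrite /C /=.
  case: ifPn => [c <-|/negP c <-]; first by left; split => //; rewrite eqxx.
  by right.
move=> [[c]|[/negP/negbTE c <-]]; rewrite c //.
by case: eqVneq.
Qed.

End nearest_point.

Lemma separable_dense_seq : separable H -> exists x : nat -> H, dense (range x).
Proof.
move=> [D [cD dD]].
have /pfcard_geP[D0|[g]] : (D #<= [set: nat])%card := cD.
  have [] := dD setT; first by exists 0.
  - exact: openT.
  - by move=> y [_]; rewrite D0.
by exists g; rewrite (_ : range g = D)//; exact: image_eq.
Qed.

End borel_functions.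

(** * Bochner integrals against a finite measure *)

Section bochner_integral.
Context d (T : measurableType d) {R : realType} {H : hilbertType R}.
Variable mu : {measure set T -> \bar R}.
Hypothesis mu_fin : (mu setT < +oo)%E.

Let integrable_indic_finite A : measurable A ->
  mu.-integrable setT (EFin \o \1_A).
Proof.
move=> mA; apply: measurable_bounded_integrable => //.
exists 1; split => // M M1 t _ /=.
by rewrite indicE ger0_norm// (le_trans _ (ltW M1))// lern1 leq_b1.
Qed.

Let simple_sum (s : T -> H) (q : H -> R) : finite_set (range s) -> forall t,
  (q (s t))%:E =
  (\sum_(v <- fset_set (range s)) (q v)%:E * (\1_(s @^-1` [set v]) t)%:E)%E.
Proof.
move=> fs t.
rewrite (bigD1_seq (s t)) /=;
  [|by rewrite in_fset_set//; apply: mem_set; exists t|exact: fset_uniq].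
rewrite indicE mem_set//= mule1 big1 ?adde0// => v vt.
rewrite indicE memNset ?mule0//= => tv.
by rewrite tv eqxx in vt.
Qed.

Lemma simple_integrable (s : T -> H) (q : H -> R) : simple_function mu s ->
  mu.-integrable setT (fun t => (q (s t))%:E).
Proof.
move=> [fs ms _]; under eq_fun do rewrite (simple_sum q fs).
apply: integrable_sum => // v _; apply: integrableZl => //.
exact: integrable_indic_finite.
Qed.

(** The weak form of the integral of a simple function replaces every use of
    additivity of simple integrals below. *)
Lemma inner_simple_integral (s : T -> H) h : simple_function mu s ->
  (inner h (simple_integral mu s))%:E = (\int[mu]_t (inner h (s t))%:E)%E.
Proof.
move=> [fs ms _].
under eq_integral do rewrite (simple_sum (inner h) fs).
rewrite integral_sum//; last first.
  by move=> v; apply: integrableZl => //; exact: integrable_indic_finite.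
rewrite /simple_integral fsbig_finite//= linear_sumr /= -sumEFin.
apply: eq_bigr => v _.
rewrite integralZl//; last exact: integrable_indic_finite.
rewrite integral_indic// setIT innerZr EFinM muleC fineK//.
by rewrite ge0_fin_numE// (le_lt_trans _ mu_fin)// le_measure ?inE.
Qed.

Lemma integrable_normH (f : T -> H) :
  measurable_fun [set: T] (f : T -> borel H) ->
  (\int[mu]_t `|f t|%:E < +oo)%E -> mu.-integrable setT (EFin \o (fun t => `|f t|)).
Proof.
move=> mf foo; apply/integrableP; split.
  by apply/measurable_EFinP; exact: measurable_normH.
by under eq_integral do rewrite /= normr_id.
Qed.

Lemma integrable_inner (f : T -> H) h :
  measurable_fun [set: T] (f : T -> borel H) ->
  (\int[mu]_t `|f t|%:E < +oo)%E ->
  mu.-integrable setT (fun t => (inner h (f t))%:E).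
Proof.
move=> mf foo.
have fi := integrable_normH mf foo.
apply: (le_integrable measurableT _ _ (integrableZl measurableT `|h| fi)).
  by apply/measurable_EFinP; exact: measurable_inner.
move=> t _; rewrite /= lee_fin normrM !normr_id; exact: cauchy_schwarz.
Qed.

Lemma integral_inner_le (f g : T -> H) h :
  mu.-integrable setT (fun t => (inner h (f t))%:E) ->
  mu.-integrable setT (fun t => (inner h (g t))%:E) ->
  measurable_fun [set: T] (fun t => `|f t - g t|) ->
  (`|\int[mu]_t (inner h (f t))%:E - \int[mu]_t (inner h (g t))%:E| <=
   `|h|%:E * \int[mu]_t `|f t - g t|%:E)%E.
Proof.
move=> fi gi mfg; rewrite -integralB//.
have fgi := integrableB measurableT fi gi.
apply: (le_trans (le_abse_integral mu measurableT (measurable_int _ fgi))).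
rewrite -ge0_integralZl_EFin//; last by apply/measurable_EFinP.
apply: ge0_le_integral => //.
- by apply: measurableT_comp => //; exact: measurable_int fgi.
- by apply: emeasurable_funM => //; exact/measurable_EFinP.
- by move=> t _; rewrite -EFinB abse_EFin lee_fin -innerBr; exact: cauchy_schwarz.
Qed.

Lemma measurable_simple_dist (f s : T -> H) : simple_function mu s ->
  measurable_fun [set: T] (f : T -> borel H) ->
  measurable_fun [set: T] (fun t => `|f t - s t|).
Proof.
move=> [fs ms _] mf.
apply: (finite_range_measurable (q := fun v t => `|f t - v|)) => // v.
exact: measurable_norm_sub.
Qed.

(** Some s n of an approximating sequence is at finite L^1 distance from f, and
    a simple function has finite L^1 norm. *)
Lemma is_bochner_integral_lty (f : T -> H) v :
  measurable_fun [set: T] (f : T -> borel H) -> is_bochner_integral mu f v ->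
  (\int[mu]_t `|f t|%:E < +oo)%E.
Proof.
move=> mf [_ [s [ss /fine_cvgP[[N _ /(_ N (leqnn N)) sfin] _] _]]].
have mfs := measurable_simple_dist (ss N) mf.
have /integrableP[mnS nSoo] := simple_integrable (fun v => `|v|) (ss N).
apply: (@le_lt_trans _ _ (\int[mu]_t (`|f t - s N t|%:E + `|s N t|%:E))%E).
  apply: ge0_le_integral => //.
  - by apply/measurable_EFinP; exact: measurable_normH.
  - by apply: emeasurable_funD => //; exact/measurable_EFinP.
  - by move=> t _; rewrite -EFinD lee_fin -[X in `|X| <= _](subrK (s N t)) ler_normD.
rewrite ge0_integralD//; last by apply/measurable_EFinP.
apply: lte_add_pinfty; first by rewrite ltey_eq sfin.
by move: nSoo; under eq_integral do rewrite /= normr_id.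
Qed.

(** The weak form of a Bochner integral passes to the limit from simple
    functions, with error at most |h| int |f - s_n|. In particular the integral
    is unique, so that the choice made by [bochner_integral] is immaterial. *)
Lemma is_bochner_integral_inner (f : T -> H) v :
  measurable_fun [set: T] (f : T -> borel H) -> is_bochner_integral mu f v ->
  forall h, (inner h v)%:E = (\int[mu]_t (inner h (f t))%:E)%E.
Proof.
move=> mf fv h; have foo := is_bochner_integral_lty mf fv.
have fi := integrable_inner h mf foo.
case: fv => _ [s [ss fs0 sv]].
have Ifin := integrable_fin_num measurableT fi.
have cinner : (inner h (simple_integral mu (s n)))%:E @[n --> \oo]
    --> (inner h v)%:E.
  apply: cvg_EFin; first exact: nearW.
  by apply: continuous_cvg sv; exact: continuous_inner.
have d0 : (\int[mu]_t (inner h (f t))%:E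
    - (inner h (simple_integral mu (s n)))%:E)%E @[n --> \oo] --> 0%E.
  apply/cvg_abse0P.
  apply: (@squeeze_cvge _ _ _ _ (cst 0%E) _
    (fun n => `|h|%:E * \int[mu]_t `|f t - s n t|%:E)%E).
  - apply: nearW => n; rewrite abse_ge0 andTb [in leLHS]/comp.
    rewrite inner_simple_integral//; apply: integral_inner_le => //.
      exact: simple_integrable.
    exact: measurable_simple_dist.
  - exact: cvg_cst.
  - by rewrite -[X in _ --> X](mule0 `|h|%:E); exact: cvgeZl.
have d1 : (\int[mu]_t (inner h (f t))%:E
    - (inner h (simple_integral mu (s n)))%:E)%E @[n --> \oo]
    --> (\int[mu]_t (inner h (f t))%:E - (inner h v)%:E)%E.
  by apply: cvgeB => //; [rewrite fin_num_adde_defl | exact: cvg_cst].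
have : _ = _ :> \bar R := cvg_unique (@ereal_hausdorff R) d0 d1.
by move=> I0; rewrite -[RHS](@subeK _ _ (inner h v)%:E)// -I0 add0e.
Qed.

(** Representing h |-> int <h, f> by a vector v avoids a Cauchy argument for the
    integrals of the simple functions s_n: testing against h = v - int s_n gives
    |h|^2 = int <h, f - s_n> <= |h| int |f - s_n|, and the last integral tends
    to 0 by dominated convergence. *)
Lemma is_bochner_integral_exists (f : T -> H) : separable H ->
  measurable_fun [set: T] (f : T -> borel H) ->
  (\int[mu]_t `|f t|%:E < +oo)%E ->
  exists v, is_bochner_integral mu f v.
Proof.
move=> /separable_dense_seq[x dx] mf foo.
pose s := nearest x f.
have ss n : simple_function mu (s n).
  split; first exact: nearest_finite.
  - by move=> v; exact: nearest_measurable.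
  - move=> v _; apply: le_lt_trans mu_fin; rewrite le_measure ?inE//.
    exact: nearest_measurable.
have sf t : s n t @[n --> \oo] --> f t by exact: cvg_nearest.
have mfs n := measurable_simple_dist (ss n) mf.
have fi := integrable_normH mf foo.
have fs0 : (\int[mu]_t `|f t - s n t|%:E)%E @[n --> \oo] --> 0%E.
  have := @dominated_cvg _ _ _ mu _ measurableT
    (fun n t => `|f t - s n t|%:E) (cst 0%E) _ _ _ _ fi.
  rewrite integral0; apply => //.
  - by move=> n; exact/measurable_EFinP.
  - move=> t _; apply: cvg_EFin; first exact: nearW.
    rewrite -[X in _ --> X](@normr0 _ H) -(subrr (f t)).
    by apply: cvg_norm; apply: cvgB => //; exact: cvg_cst.
  - by move=> n t _; rewrite abse_EFin normr_id lee_fin; exact: nearest_dist.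
have ffin : (\int[mu]_t `|f t|%:E)%E \is a fin_num.
  by rewrite ge0_fin_numE//; apply: integral_ge0 => t _; rewrite lee_fin.
pose l h : R^o := fine (\int[mu]_t (inner h (f t))%:E).
have lE h : (l h)%:E = (\int[mu]_t (inner h (f t))%:E)%E.
  by rewrite fineK//; apply: integrable_fin_num => //; exact: integrable_inner.
have l_lin : scalar l.
  move=> c g h; apply: EFin_inj; rewrite EFinD EFinM !lE.
  rewrite -integralZl//; last exact: integrable_inner.
  rewrite -integralD//; last 2 first.
    by apply: integrableZl => //; exact: integrable_inner.
    exact: integrable_inner.
  by apply: eq_integral => t _; rewrite -EFinM -EFinD linearPl.
pose lH := GRing.isLinear.Build _ _ _ _ l l_lin.
pose L : {scalar H} := HB.pack l lH.
have [v vE] : exists v, forall h, L h = inner h v.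
  apply: (@riesz _ _ L (fine (\int[mu]_t `|f t|%:E))) => h.
  have := @integral_inner_le f (cst 0) h (integrable_inner h mf foo) _ _.
  rewrite -lE -lee_fin EFinM (fineK ffin).
  under eq_integral do rewrite linear0r.
  rewrite integral0 sube0 muleC.
  under eq_integral do rewrite subr0.
  apply.
    by under eq_fun do rewrite linear0r; exact: integrable0.
  by under eq_fun do rewrite subr0; exact: measurable_normH.
exists v; split; first by exists s.
exists s; split => //.
have vs n : (`|v - simple_integral mu (s n)|%:E <= \int[mu]_t `|f t - s n t|%:E)%E.
  set h := v - _.
  have [->|h0] := eqVneq h 0; first by rewrite normr0 integral_ge0// => t _; rewrite lee_fin.
  have : (`|h|%:E * `|h|%:E <= `|h|%:E * \int[mu]_t `|f t - s n t|%:E)%E.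
    rewrite -EFinM -expr2 -inner_norm {2}/h innerBr -vE EFinB lE.
    rewrite inner_simple_integral//.
    apply: le_trans (integral_inner_le (integrable_inner h mf foo) _ (mfs n)).
      exact: lee_abs.
    exact: simple_integrable.
  by rewrite lee_pmul2l// lte_fin normr_gt0.
apply/cvgrPdist_le => e e0.
have /fine_cvgP[sfin /cvgrPdist_le /(_ _ e0)] := fs0.
apply: filterS2 sfin => n sfin /=.
rewrite sub0r normrN => ne; rewrite -lee_fin; apply: (le_trans (vs n)).
by rewrite -(fineK sfin) lee_fin; apply: le_trans ne; exact: ler_norm.
Qed.

Lemma inner_bochner_integral (f : T -> H) : separable H ->
  measurable_fun [set: T] (f : T -> borel H) ->
  (\int[mu]_t `|f t|%:E < +oo)%E ->
  forall h, (inner h (bochner_integral mu f))%:E =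
            (\int[mu]_t (inner h (f t))%:E)%E.
Proof.
move=> sepH mf foo; apply: is_bochner_integral_inner => //.
have [v fv] := is_bochner_integral_exists sepH mf foo.
by rewrite /bochner_integral; case: xgetP => [w _ //|/(_ v)].
Qed.

Lemma bochner_integral_default (f : T -> H) :
  measurable_fun [set: T] (f : T -> borel H) ->
  ~~ (\int[mu]_t `|f t|%:E < +oo)%E -> bochner_integral mu f = 0.
Proof.
move=> mf foo; rewrite /bochner_integral; case: xgetP => // v _ fv.
by move/negP : foo; have := is_bochner_integral_lty mf fv.
Qed.

End bochner_integral.

(** * Measurability of norms, the L2 norm and integration of kernels *)

Lemma measurable_norm_sqr_weak d (T : measurableType d) (R : realType)
    (H : hilbertType R) (g : T -> H) : separable H ->
  (forall h, measurable_fun [set: T] (fun t => inner h (g t))) ->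
  measurable_fun [set: T] (fun t => `|g t| ^+ 2).
Proof.
move=> /separable_dense_seq[x dx] mg; apply/measurable_EFinP.
have -> : EFin \o (fun t => `|g t| ^+ 2) = (fun t =>
    esups (fun n => (2 * inner (x n) (g t) - `|x n| ^+ 2)%:E) 0).
  apply/funext => t /=; rewrite (norm_sqr_sup (g t) dx); congr ereal_sup.
  by apply/seteqP; split => _ [n _ <-]; exists n.
apply: measurable_fun_esups => n; apply/measurable_EFinP.
by apply: measurable_funB => //; apply: measurable_funM.
Qed.

Lemma Lnorm2_sqr d (T : measurableType d) (R : realType)
    (mu : {measure set T -> \bar R}) (f : T -> R) :
  ('N[mu]_2%:E[EFin \o f] ^+ 2)%E = (\int[mu]_t (`|f t| ^+ 2)%:E)%E.
Proof.
rewrite unlock poweR12_sqrt; last first.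
  by apply: integral_ge0 => t _; exact: poweR_ge0.
rewrite sqr_sqrte; last by apply: integral_ge0 => t _; exact: poweR_ge0.
by apply: eq_integral => t _; rewrite /= powR_mulrn.
Qed.

Section kernel_integration.
Context d d' (X : measurableType d) (Y : measurableType d') (R : realType).
Local Open Scope ereal_scope.
Import HBNNSimple.

Lemma measurable_kernel_integral (k : R.-ker X ~> Y) (f : Y -> R) :
  measurable_fun [set: Y] f ->
  measurable_fun [set: X] (fun x => \int[k x]_y (f y)%:E).
Proof.
move=> mf; under eq_fun do rewrite integralE.
apply: emeasurable_funB; apply: measurable_fun_integral_kernel => //.
- exact: measurable_kernel.
- by apply: measurable_funepos; exact/measurable_EFinP.
- exact: measurable_kernel.
- by apply: measurable_funeneg; exact/measurable_EFinP.
Qed.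

(** If nu is the mixture of the measures k x under mu on sets, then it is so on
    nonnegative functions: the identity holds for simple functions by linearity,
    and both sides are continuous along their monotone limits. *)
Lemma ge0_integral_kernel (mu : {measure set X -> \bar R})
    (nu : {measure set Y -> \bar R}) (k : R.-ker X ~> Y) (f : Y -> \bar R) :
  (forall B, measurable B -> nu B = \int[mu]_x k x B) ->
  (forall y, 0 <= f y) -> measurable_fun [set: Y] f ->
  \int[nu]_y f y = \int[mu]_x \int[k x]_y f y.
Proof.
move=> nuE f0 mf; pose g := nnsfun_approx measurableT mf.
have nd_g y : {homo (fun n => g n y) : m n / (m <= n)%N >-> (m <= n)%R}.
  by move=> m n mn; exact/lefP/nd_nnsfun_approx.
have mg n : measurable_fun [set: Y] (fun y => (g n y)%:E).
  exact/measurable_EFinP.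
have cvg_g (m : {measure set Y -> \bar R}) :
    \int[m]_y (g n y)%:E @[n --> \oo] --> \int[m]_y f y.
  rewrite [X in _ --> X](_ : _ = \int[m]_y limn (fun n => (g n y)%:E)).
    apply: cvg_monotone_convergence => // [n y _|y _ a b ab].
      by rewrite lee_fin.
    by rewrite lee_fin; exact: nd_g.
  apply: eq_integral => y _; apply/esym/cvg_lim => //.
  exact: cvg_nnsfun_approx.
have g_eq n : \int[nu]_y (g n y)%:E = \int[mu]_x \int[k x]_y (g n y)%:E.
  rewrite integralT_nnsfun sintegralE.
  under [RHS]eq_integral do rewrite integralT_nnsfun sintegralE.
  rewrite ge0_integral_fsum//.
  - apply: eq_fsbigr => r; rewrite inE => -[y _ <-].
    rewrite nuE// -ge0_integralZl_EFin//.
    exact: measurable_kernel.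
  - by move=> r; apply: emeasurable_funM => //; exact: measurable_kernel.
  - by move=> r x _; exact: nnsfun_mulemu_ge0.
have k_cvg : \int[mu]_x \int[k x]_y (g n y)%:E @[n --> \oo] -->
    \int[mu]_x \int[k x]_y f y.
  rewrite [X in _ --> X](_ : _ =
      \int[mu]_x limn (fun n => \int[k x]_y (g n y)%:E)).
    apply: cvg_monotone_convergence => // [n|n x _|x _ a b ab].
    - apply: measurable_fun_integral_kernel => //; first exact: measurable_kernel.
      by move=> y; rewrite lee_fin.
    - by apply: integral_ge0 => y _; rewrite lee_fin.
    - apply: ge0_le_integral => // [y _|y _]; rewrite lee_fin//.
      exact: nd_g.
  by apply: eq_integral => x _; apply/esym/cvg_lim => //; exact: cvg_g.
apply: cvg_unique (cvg_g nu) _ => //.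
by rewrite (funext g_eq).
Qed.
End kernel_integration.

(** * The upper bound *)

Section upper_bound.
Context {R : realType} {E : ptopologicalType}.
Variable p : R.-pker (borel E) ~> (borel E).
Context {k : E -> E -> R} {H : rkhs k}.
Hypothesis sepH : separable H.
Hypothesis mphi : measurable_fun [set: borel E] (feature H : borel E -> borel H).

Let rkhs_funE h : rkhs_fun H h = (fun x => inner h (feature H x)).
Proof. by apply/funext => x; rewrite reproducing. Qed.

Let prob_lty x : (p x [set: borel E] < +oo)%E.
Proof. by rewrite prob_kernel ltry. Qed.

(** The points at which the conditional Bochner expectation exists. *)
Let good : set (borel E) := [set x | (\int[p x]_y `|feature H y|%:E < +oo)%E].

Let measurable_good : measurable good.
Proof.
have mn : measurable_fun [set: borel E]
    (fun x => \int[p x]_y `|feature H y|%:E)%E.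
  by apply: measurable_kernel_integral; exact: measurable_normH.
by rewrite -[good]setTI; exact: emeasurable_fun_infty_o.
Qed.

Lemma inner_condexp_feature x h :
  (\int[p x]_y `|feature H y|%:E < +oo)%E ->
  inner h (condexp_feature p H x) = condexp_op p (rkhs_fun H h) x.
Proof.
move=> xoo; apply: EFin_inj; rewrite inner_bochner_integral//.
have fi := integrable_inner h mphi xoo.
rewrite /condexp_op /Rintegral fineK; last first.
  by rewrite rkhs_funE; exact: integrable_fin_num fi.
by rewrite rkhs_funE.
Qed.

Lemma measurable_condexp_op h :
  measurable_fun [set: borel E] (condexp_op p (rkhs_fun H h)).
Proof.
apply: measurableT_comp; first exact: fine_measurable.
apply: measurable_kernel_integral.
by rewrite rkhs_funE; exact: measurable_inner.
Qed.

(** Off the measurable set where phi is p(x, .)-integrable, [condexp_feature]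
    takes the default value 0, hence the indicator. *)
Lemma measurable_inner_condexp_feature h :
  measurable_fun [set: borel E] (fun x => inner h (condexp_feature p H x)).
Proof.
rewrite (_ : (fun _ => _) = condexp_op p (rkhs_fun H h) \* \1_good).
  by apply: measurable_funM; [exact: measurable_condexp_op|exact: measurable_indic].
apply/funext => x /=; rewrite indicE.
have [xoo|xoo] := boolP (x \in good).
  by rewrite mulr1 inner_condexp_feature//; exact: set_mem xoo.
rewrite /= mulr0 /condexp_feature bochner_integral_default ?linear0r//.
by apply/negP => xoo'; move/negP : xoo; apply; exact: mem_set.
Qed.

Section operator.
Variable A : {linear H -> H}.
Hypothesis cA : continuous A.

Lemma measurable_feature_error :
  measurable_fun [set: borel E] (fun x => `|feature_error p A x| ^+ 2).
Proof.
apply: measurable_norm_sqr_weak sepH _ => h.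
under eq_fun do rewrite innerBr adjointE//.
apply: measurable_funB; first exact: measurable_inner_condexp_feature.
exact: measurable_inner.
Qed.

(** Both terms of the error are components along h: A h evaluates at x to
    <A h, phi(x)> = <h, A^* phi(x)>, and the conditional expectation of h is
    <h, F_p(x)> by the weak form of the Bochner integral. *)
Lemma operator_errorE x h : (\int[p x]_y `|feature H y|%:E < +oo)%E ->
  operator_error p A h x = - inner h (feature_error p A x).
Proof.
move=> xoo; rewrite /operator_error /feature_error innerBr opprB adjointE//.
by rewrite reproducing inner_condexp_feature.
Qed.

Lemma measurable_operator_error h :
  measurable_fun [set: borel E] (operator_error p A h).
Proof.
apply: measurable_funB; last exact: measurable_condexp_op.
by rewrite rkhs_funE; exact: measurable_inner.
Qed.

Context d (Omega : measurableType d) (P : probability Omega R).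
Variables X Y : {RV P >-> borel E}.
Hypothesis pXY : regular_conditional_distribution X Y p.
Hypothesis phiY2 : ('E_P[(fun w => `|feature H (Y w)| ^+ 2)%R] < +oo)%E.

Lemma expectation_feature_error :
  ('E_P[(fun w => `|feature_error p A (X w)| ^+ 2)%R] =
   bochner_L2norm (distribution P X) (feature_error p A) ^+ 2)%E.
Proof.
rewrite /bochner_L2norm Lnorm2_sqr unlock.
under [RHS]eq_integral do rewrite normr_id.
rewrite ge0_integral_distribution//.
by apply/measurable_EFinP; exact: measurable_feature_error.
Qed.

(** The law of Y is the mixture of the p(x, .) under the law of X, so that the
    p(x, .)-integrals of |phi| average to E |phi(Y)| <= 1 + E |phi(Y)|^2; a
    nonnegative function with finite integral is finite almost everywhere. *)
Lemma integrable_feature_ae : {ae distribution P X, forall x,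
  (\int[p x]_y `|feature H y|%:E < +oo)%E}.
Proof.
have mnphi : measurable_fun [set: borel E] (fun y => `|feature H y|%:E).
  by apply/measurable_EFinP; exact: measurable_normH.
have intE : (\int[distribution P Y]_y `|feature H y|%:E =
    \int[distribution P X]_x \int[p x]_y `|feature H y|%:E)%E.
  apply: ge0_integral_kernel => // B mB.
  by rewrite -pXY// preimage_setT setTI.
have int_lty : (\int[distribution P Y]_y `|feature H y|%:E < +oo)%E.
  rewrite ge0_integral_distribution//.
  move: phiY2; rewrite unlock => phiY2'.
  have mphi2 : measurable_fun [set: Omega] (fun w => `|feature H (Y w)| ^+ 2).
    apply: measurable_funX.
    by apply: (measurableT_comp (measurable_normH mphi)).
  apply: (@le_lt_trans _ _ (\int[P]_w (1 + (`|feature H (Y w)| ^+ 2)%:E))%E).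
    apply: ge0_le_integral => //.
    - by move=> w _; rewrite lee_fin.
    - by apply: (measurableT_comp mnphi).
    - by apply: emeasurable_funD => //; exact/measurable_EFinP.
    - by move=> w _ /=; rewrite -EFinD lee_fin; nra.
  rewrite ge0_integralD//; last by apply/measurable_EFinP.
  rewrite lte_add_pinfty// integral_cst// mul1e.
  by rewrite (le_lt_trans (probability_le1 P _))// ltry.
have /integrable_ae : (distribution P X).-integrable setT
    (fun x => \int[p x]_y `|feature H y|%:E)%E.
  apply/integrableP; split.
    by apply: measurable_kernel_integral; exact: measurable_normH.
  under eq_integral do rewrite gee0_abs ?integral_ge0//.
  by rewrite -intE.
move=> /(_ measurableT); apply: filterS => x /(_ Logic.I).
by rewrite fin_numE => /andP[_]; rewrite ltey.
Qed.

Lemma opnorm_L2_le : (opnorm_L2 (distribution P X) (operator_error p A) ^+ 2 <=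
  'E_P[(fun w => `|feature_error p A (X w)| ^+ 2)%R])%E.
Proof.
have merr := measurable_feature_error.
have -> : ('E_P[(fun w => `|feature_error p A (X w)| ^+ 2)%R])%E =
    ('N[distribution P X]_2%:E[EFin \o (fun x => `|feature_error p A x|)%R] ^+ 2)%E.
  exact: expectation_feature_error.
rewrite lee_sqr ?Lnorm_ge0//; last first.
  apply: le_trans (ereal_sup_ubound _); last first.
    by exists 0 => //=; rewrite normr0.
  exact: Lnorm_ge0.
apply: ge_ereal_sup => _ [h /= h1 <-].
apply: lee_sqrE; first exact: Lnorm_ge0.
rewrite !Lnorm2_sqr; apply: ae_ge0_le_integral => //.
- apply/measurable_EFinP; apply: measurable_funX; apply: measurableT_comp => //.
  exact: measurable_operator_error.
- by apply/measurable_EFinP; under eq_fun do rewrite normr_id.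
apply: filterS integrable_feature_ae => x xoo _.
rewrite operator_errorE// normrN lee_fin normr_id ler_sqr ?nnegrE//.
by rewrite (le_trans (cauchy_schwarz _ _))// ler_piMl.
Qed.

End operator.
End upper_bound.

(** * Sharpness *)

Section real_line_hilbert.
Variable R : realType.

Definition mul_form (x y : R^o) : R := x * y.

Lemma mul_form_bilinear : bilinear_for
  (GRing.Scale.Law.clone _ _ ( *%R : R -> R -> R) _)
  (GRing.Scale.Law.clone _ _ (idfun \; *%R : R -> R -> R) _) mul_form.
Proof.
by split=> [y|x] c u v; rewrite /mul_form /= ?mulrDl ?mulrDr ?mulrA// (mulrC x).
Qed.

HB.instance Definition _ := bilinear_isBilinear.Build R R^o R^o R
  (GRing.Scale.Law.clone _ _ ( *%R : R -> R -> R) _)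
  (GRing.Scale.Law.clone _ _ (idfun \; *%R : R -> R -> R) _)
  mul_form mul_form_bilinear.

Lemma mul_form_sym (x y : R^o) :
  mul_form x y = (-1) ^+ false * idfun (mul_form y x).
Proof. by rewrite expr0 mul1r /= /mul_form mulrC. Qed.

HB.instance Definition _ :=
  @isHermitianSesquilinear.Build R R^o false idfun mul_form mul_form_sym.

Lemma mul_form_gt0 (x : R^o) : x != 0 -> 0 < mul_form x x.
Proof. by move=> x0; rewrite /mul_form -expr2 lt_def sqr_ge0 sqrf_eq0 x0. Qed.

HB.instance Definition _ := @isDotProduct.Build R R^o mul_form mul_form_gt0.

Lemma mul_form_norm (x : R^o) : mul_form x x = `|x| ^+ 2.
Proof. by rewrite /mul_form -expr2 real_normK ?num_real. Qed.

HB.instance Definition _ :=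
  @CompleteNormedModule_isHilbert.Build R R^o mul_form mul_form_norm.

Lemma separable_real_line : separable R^o.
Proof.
exists (@ratr R @` setT); split; last exact: dense_rat.
by apply: (card_le_trans (card_image_le _ _)); exact: countableP.
Qed.

End real_line_hilbert.

Lemma second_countable_bool : @second_countable bool.
Proof.
exists (range (fun b : bool => [set b])).
  by apply: finite_set_countable; apply: finite_image; exact: finite_finset.
split; first by move=> _ [b _ <-]; exact: discrete_open.
move=> b U Ub; exists [set b].
  by split => //; exists b.
by move=> _ ->; exact: nbhs_singleton.
Qed.

Lemma locally_compact_bool : locally_compact [set: bool].
Proof.
move=> b _; rewrite withinET; exists setT; first exact: filterT.
by split; [exact: bool_compact | exact: closedT].
Qed.

Section constant_kernel.
Variable R : realType.

Definition constant_function (h : R^o) : bool -> R^o := cst h.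

Lemma constant_function_linear : linear constant_function.
Proof. by []. Qed.

HB.instance Definition _ := GRing.isLinear.Build R R^o (bool -> R^o) _
  constant_function constant_function_linear.

Lemma constant_function_inj : injective constant_function.
Proof. by move=> g h /(congr1 (@^~ true)). Qed.

Definition constant_rkhs : rkhs (fun _ _ : bool => 1 : R) :=
  @RKHS R bool _ R^o constant_function constant_function_inj (fun=> 1)
    (fun=> erefl) (fun h x => mulr1 h).

End constant_kernel.

Lemma hilbert_schmidt0 (R : realType) :
  hilbert_schmidt (\0 : {linear R^o -> R^o}).
Proof.
split; first exact: cst_continuous.
exists [set 1]; split.
  split=> [_ _ -> ->|w /(_ 1 erefl)]; first by rewrite eqxx /inner/= /mul_form mulr1.
  by rewrite /inner /= /mul_form mulr1.
by rewrite esum1// => e _; rewrite normr0 expr0n.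
Qed.

Section constant_pair.
Variable R : realType.

Definition true_law : probability (borel bool) R := \d_(true : borel bool).
Let P := true_law.
Let X : {RV P >-> borel bool} := cst true.

Let measurable_true :
  measurable_fun [set: borel bool] (cst true : borel bool -> borel bool).
Proof. exact: measurable_cst. Qed.

Let p : R.-pker (borel bool) ~> (borel bool) := kdirac measurable_true.
Let H : rkhs (fun _ _ : bool => 1 : R) := constant_rkhs R.
Let A : {linear H -> H} := \0.

Lemma constant_pair_conditional : regular_conditional_distribution X X p.
Proof.
move=> B C mB mC.
rewrite -[RHS]/(\int[_]_(x in B) cst (P C) x)%E integral_cst//.
rewrite -[RHS]/(P C * P (X @^-1` B))%E !preimage_cst /P /true_law.
rewrite [LHS]diracE [X in (X * _)%E]diracE [X in (_ * X)%E]diracE in_setI.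
by case: (true \in B); case: (true \in C);
  rewrite ?in_setT ?in_set0 /= ?mule1 ?mule0 ?mul0e.
Qed.

Lemma constant_pair_feature : feature_assumptions X X H.
Proof.
by split; [exact: separable_real_line | exact: measurable_cst | |];
  rewrite (_ : (fun _ => _) = cst 1) ?expectation_cst ?ltry//;
  apply/funext => w /=; rewrite normr1 expr1n.
Qed.

Let constant_pair_feature_integral x : (\int[p x]_y `|feature H y|%:E = 1)%E.
Proof.
rewrite -[RHS](prob_kernel (s := p) x) -[RHS]mul1e -integral_cst//.
by apply: eq_integral => y _; rewrite normr1.
Qed.

Lemma constant_pair_feature_error x : feature_error p A x = 1.
Proof.
have [sepH mphi _ _] := constant_pair_feature.
have -> : feature_error p A x = condexp_feature p H x.
  rewrite /feature_error [X in _ - X](_ : _ = 0) ?subr0//.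
  apply: innerr_eq => h; rewrite adjointE; last exact: cst_continuous.
  by rewrite linear0r linear0l.
have := @inner_condexp_feature _ _ p _ H sepH mphi x (1 : R^o).
rewrite constant_pair_feature_integral => /(_ (ltry _)).
rewrite /inner /= /mul_form mul1r => ->.
rewrite /condexp_op /constant_function Rintegral_cst// mul1r.
by rewrite -[RHS]/(fine 1%E); congr fine; exact: prob_kernel.
Qed.

Lemma constant_pair_error :
  ('E_P[(fun w => `|feature_error p A (X w)| ^+ 2)%R] = 1)%E.
Proof.
rewrite (_ : (fun _ => _) = cst 1) ?expectation_cst//.
by apply/funext => w; rewrite constant_pair_feature_error normr1 expr1n.
Qed.

(** At most 1 by the upper bound; at least 1 because A = 0 makes the error at the
    constant function 1 equal to -1. *)
Lemma constant_pair_opnorm :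
  (opnorm_L2 (distribution P X) (operator_error p A) ^+ 2 = 1)%E.
Proof.
have [sepH mphi _ phi2] := constant_pair_feature.
apply/eqP; rewrite eq_le; apply/andP; split.
  rewrite -constant_pair_error; apply: opnorm_L2_le => //.
    exact: cst_continuous.
  exact: constant_pair_conditional.
have <- : ('N[distribution P X]_2%:E[EFin \o operator_error p A (1%R : R^o)] ^+ 2
    = 1)%E.
  rewrite Lnorm2_sqr -[RHS](probability_setT (distribution P X)) -[RHS]mul1e.
  rewrite -integral_cst//; apply: eq_integral => x _ /=.
  rewrite operator_errorE//; last by rewrite constant_pair_feature_integral ltry.
    rewrite constant_pair_feature_error /inner /= /mul_form mulr1.
    by rewrite normrN normr1 expr1n.
  exact: cst_continuous.
have le_op : ('N[distribution P X]_2%:E[EFin \o operator_error p A (1%R : R^o)]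
    <= opnorm_L2 (distribution P X) (operator_error p A))%E.
  by apply: ereal_sup_ubound; exists (1 : R^o) => //=; rewrite normr1.
by rewrite lee_sqr ?Lnorm_ge0// (le_trans _ le_op) ?Lnorm_ge0.
Qed.

End constant_pair.

Local Open Scope ereal_scope.

Theorem theorem3p6 (R : realType) :
  (forall (E : ptopologicalType) (d : measure_display)
      (Omega : measurableType d) (P : probability Omega R)
      (X Y : {RV P >-> borel E}) (p : R.-pker (borel E) ~> (borel E))
      (k : E -> E -> R) (H : rkhs k) (A : {linear H -> H}),
    @second_countable E -> locally_compact [set: E] -> hausdorff_space E ->
    regular_conditional_distribution X Y p ->
    feature_assumptions X Y H ->
    hilbert_schmidt A ->
    (opnorm_L2 (distribution P X) (operator_error p A)) ^+ 2
      <= 'E_P[(fun w => `|feature_error p A (X w)| ^+ 2)%R] /\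
    'E_P[(fun w => `|feature_error p A (X w)| ^+ 2)%R]
      = (bochner_L2norm (distribution P X) (feature_error p A)) ^+ 2) /\
  (exists (E : ptopologicalType) (d : measure_display)
      (Omega : measurableType d) (P : probability Omega R)
      (X Y : {RV P >-> borel E}) (p : R.-pker (borel E) ~> (borel E))
      (k : E -> E -> R) (H : rkhs k) (A : {linear H -> H}),
    [/\ @second_countable E, locally_compact [set: E] & hausdorff_space E] /\
    regular_conditional_distribution X Y p /\
    feature_assumptions X Y H /\
    hilbert_schmidt A /\
    (opnorm_L2 (distribution P X) (operator_error p A)) ^+ 2
      = 'E_P[(fun w => `|feature_error p A (X w)| ^+ 2)%R] /\
    (opnorm_L2 (distribution P X) (operator_error p A)) ^+ 2 != 0 /\
    'E_P[(fun w => `|feature_error p A (X w)| ^+ 2)%R] != 0).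
Proof.
split=> [E d Omega P X Y p k H A _ _ _ pXY [sepH mphi _ phiY2] [cA _]|].
  split; first exact: (@opnorm_L2_le R E p k H sepH mphi A cA d Omega P X Y).
  exact: expectation_feature_error.
exists bool, _, (borel bool), (true_law R), (cst true), (cst true).
exists (kdirac (measurable_cst (true : borel bool))), (fun _ _ => 1%R).
exists (constant_rkhs R), \0.
split; first by split; [exact: second_countable_bool |
  exact: locally_compact_bool | exact: discrete_hausdorff].
split; first exact: constant_pair_conditional.
split; first exact: constant_pair_feature.
split; first exact: hilbert_schmidt0.
have opE := constant_pair_opnorm R; have errE := constant_pair_error R.
split; first exact: etrans opE (esym errE).
by split; [rewrite [X in X != _]opE | rewrite [X in X != _]errE]; rewrite onee_eq0.
Qed.
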